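(* Let $m\ge1$ and $n\ge 1$ be integers and let $C_m$ be the directed $m$-cycle. The number $s_n(\mathbb{A}(C_m))=C_{m,n-1}$ equals the number of zag sequences $(d_1,\dots,d_n)$ of length $n$ satisfying \[ d_{i+1}-d_i \in \{ 2-m,3-m,\dots,0,1 \} \quad\text{for all } i\in\{1,\dots,n-1\}. \] Furthermore, $s_n(\mathbb{A}(C_m))=C_{m,n-1}$ equals the number of Dyck paths of semilength $n-1$ that do not contain $D\cdots DU=D^mU$ (that is, $m$ consecutive down-steps immediately followed by an up-step).
   Context: The directed $m$-cycle $C_m$ is the digraph with vertex set $\mathbb{Z}_m$ and edges $(i,i+1)$, $i\in\mathbb{Z}_m$ (for $m=1$: one vertex with a loop). For $m=1$ the set $\{2-m,\dots,1\}$ is $\{1\}$. Graph algebra of a digraph $G=(V,E)$: $\mathbb{A}(G)=(V\cup\{\infty\};\circ,\infty)$ with $\infty\notin V$, where $x\circ y=x$ if $(x,y)\in E$ and $x\circ y=\infty$ otherwise. $B_n$ is the set of bracketings of size $n$: groupoid terms obtained from the string $x_1x_2\cdots x_n$ of distinct variables (in this order) by inserting parentheses so that the product is unambiguous. $s_n(\mathbb{A}(G))$ is the number of distinct $n$-ary operations on $V\cup\{\infty\}$ induced by the elements of $B_n$. The notation $C_{m,n}$ (modular Catalan number) is defined here by $C_{m,n}:=s_{n+1}(\mathbb{A}(C_m))$. A zag sequence of length $n$ is a sequence $(d_1,\dots,d_n)$ of nonnegative integers with $d_1=0$, $d_2=1$ (if $n\ge2$), and $1\le d_{i+1}\le d_i+1$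 for all $i\in\{1,\dots,n-1\}$. A Dyck path of semilength $k$ is a lattice path from $(0,0)$ to $(2k,0)$ consisting of $k$ up-steps $U=(1,1)$ and $k$ down-steps $D=(1,-1)$ that never goes below the $x$-axis; ''contain'' refers to consecutive steps. *)

(* Defs.v *)
From mathcomp Require Import all_boot all_order all_algebra.
From mathcomp Require Import boolp classical_sets functions cardinality.

Set Implicit Arguments.
Unset Strict Implicit.
Unset Printing Implicit Defensive.

Import Order.TTheory GRing.Theory Num.Theory.

Inductive term (X : Type) : Type :=
| Var of X
| Mul of term X & term X.

Fixpoint vars (X : Type) (t : term X) : seq X :=
  match t with
  | Var x => [:: x]
  | Mul t1 t2 => vars t1 ++ vars t2
  end.

Fixpoint eval (X A : Type) (op : A -> A -> A) (a : X -> A) (t : term X) : A :=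
  match t with
  | Var x => a x
  | Mul t1 t2 => op (eval op a t1) (eval op a t2)
  end.

(* The variables x_1, ..., x_n are the elements of 'I_n, shifted by one. *)
Definition bracketing (n : nat) (t : term 'I_n) : Prop := vars t = enum 'I_n.

Definition term_op (A : finType) (op : A -> A -> A) (n : nat) (t : term 'I_n) :
    {ffun {ffun 'I_n -> A} -> A} :=
  [ffun a : {ffun 'I_n -> A} => eval op a t].

(* s_n of the groupoid (A; op). *)
Definition assoc_spectrum (A : finType) (op : A -> A -> A) (n : nat) : nat :=
  #|[pred f : {ffun {ffun 'I_n -> A} -> A} |
      `[< exists2 t, bracketing t & f = term_op op t >]]|.

(* The graph algebra of (V, E) has carrier option V, None being infinity. *)
Definition graph_mul (V : Type) (E : rel V) (x y : option V) : option V :=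
  match x, y with
  | Some u, Some v => if E u v then Some u else None
  | _, _ => None
  end.

(* Z_m is 'I_m with ordS i = i + 1 mod m; 'Z_m would be wrong for m = 1. *)
Definition dicycle (m : nat) : rel 'I_m := [rel i j | j == ordS i].
Arguments dicycle m : clear implicits.

Definition modular_catalan (m n : nat) : nat :=
  assoc_spectrum (graph_mul (dicycle m)) n.+1.

(* d_i is nth 0 d (i - 1). *)
Definition zag (d : seq nat) : Prop :=
  [/\ nth 0 d 0 = 0,
      1 < size d -> nth 0 d 1 = 1
    & forall i, i.+1 < size d -> 1 <= nth 0 d i.+1 <= nth 0 d i + 1].

Definition steps_within (m : nat) (d : seq nat) : Prop :=
  forall i, i.+1 < size d ->
    (2 - m%:Z <= (nth 0%N d i.+1)%:Z - (nth 0%N d i)%:Z <= 1)%R.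

Definition U : bool := true.
Definition D : bool := false.

Definition height (p : seq bool) : int :=
  (\sum_(s <- p) (if s == U then 1 else - 1))%R.

Definition dyck (k : nat) (p : seq bool) : Prop :=
  [/\ count_mem U p = k,
      count_mem D p = k
    & forall i, (0 <= height (take i p))%R].

(* Main.v *)
Require Import Defs.
From mathcomp Require Import all_boot all_order all_algebra.
From mathcomp Require Import boolp classical_sets functions cardinality.
From mathcomp Require Import zify.

(** Draw an edge from the leftmost variable of t1 to that of t2 for every
    subterm t1 t2 of a bracketing t: the result is a rooted tree whose preorder
    is the order of the variables.  In a graph algebra, t evaluates to the value
    at the root if the assignment is a homomorphism from this tree to the graph,
    and to infinity otherwise.  On a directed m-cycle a homomorphism is fixed by
    the image k of the root, because a vertex of depth d must go to k + d
    ([eval_depths]).  Hence the term operation depends exactly on the sequence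
    of depths modulo m ([term_op_cycle], [eq_cycle_op]).

    The depth sequences of bracketings are all the zag sequences ([depths_zag],
    [depths_surj]), so what remains is to count zag sequences modulo m.  Each
    class contains exactly one sequence with steps in {2 - m, ..., 1}: going
    from left to right, choose the largest entry of the prescribed residue that
    exceeds the previous entry by at most 1.  The sequence obtained dominates
    every zag sequence of its class, so that its entries remain positive
    ([short_rep_exists]), and the choice is forced because m consecutive
    integers have distinct residues ([short_rep_unique]).

    Finally, a zag sequence without its initial 0 lists the heights reached by
    the up-steps of a Dyck path.  Between up-steps reaching x and y the path has
    x + 1 - y down-steps; hence y - x >= 2 - m says that this run is shorter
    than m, and all these conditions together say that the path does not
    contain D^m U ([short_avoids]). *)

Set Implicit Arguments.
Unset Strict Implicit.
Unset Printing Implicit Defensive.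

Local Open Scope classical_set_scope.
Local Open Scope card_scope.

(** * Steps of zag sequences *)

Definition zag_step : rel nat := [rel x y | 0 < y <= x.+1].

Definition short_step (m : nat) : rel nat :=
  [rel x y | zag_step x y && (x.+1 - y < m)].

Lemma path_short_zag (m x : nat) (p : seq nat) :
  path (short_step m) x p -> path zag_step x p.
Proof. by rewrite path_relI => /andP[]. Qed.

(** Once the initial 0 is removed, the condition on the second entry is the
    instance 0 < y <= 1 of the general step condition. *)
Lemma zag_consE (x : nat) (p : seq nat) :
  zag (x :: p) <-> x = 0 /\ path zag_step 0 p.
Proof.
split=> [[/= -> _ steps]|[-> /(pathP 0) steps]].
  by split=> //; apply/(pathP 0) => i /steps; rewrite addn1.
split=> // [|i /steps]; last by rewrite /= addn1.
by case: p steps => // y p /(_ 0 isT) /=; case: y => [|[]].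
Qed.

Lemma zag_short_consE (m x : nat) (p : seq nat) :
  zag (x :: p) /\ steps_within m (x :: p) <->
  x = 0 /\ path (short_step m) 0 p.
Proof.
rewrite zag_consE; split=> [[[-> zp] sp]|[-> sp]].
  split=> //; apply/(pathP 0) => i lti /=.
  have /= := pathP 0 zp i lti; have := sp i lti.
  by rewrite /short_step /zag_step /=; lia.
split; first by split=> //; exact: path_short_zag sp.
by move=> i lti; have := pathP 0 sp i lti; rewrite /short_step /zag_step /=; lia.
Qed.

(** * Zag sequences modulo m *)

(** The two starting points differ because the induction compares a given zag
    sequence with a representative that has already risen to x' >= x; this
    domination is what keeps the representative positive. *)
Lemma short_rep_exists (m x x' : nat) (p : seq nat) :
    0 < m -> path zag_step x p -> x <= x' ->
  exists2 q, path (short_step m) x' q & map (modn^~ m) q = map (modn^~ m) p.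
Proof.
move=> m_gt0; elim: p x x' => [|y p IHp] x x' /=; first by exists [::].
move=> /andP[/andP[y_gt0 leyx] zp] lexx'.
(* The largest number congruent to y modulo m that is at most x'.+1. *)
pose y' := y + (x'.+1 - y) %/ m * m.
have def_x' : x'.+1 = y' + (x'.+1 - y) %% m.
  by rewrite -addnA -divn_eq subnKC //; lia.
have leyy' : y <= y' by exact: leq_addr.
have [q sq eq_qp] := IHp y y' zp leyy'.
exists (y' :: q); last by rewrite /= eq_qp /y' addnC modnMDl.
rewrite /= sq andbT /short_step /zag_step /= (leq_trans y_gt0 leyy').
by rewrite {1}def_x' leq_addr [in X in X - _]def_x' addKn ltn_pmod.
Qed.

Lemma short_rep_unique (m x : nat) (p q : seq nat) :
    path (short_step m) x p -> path (short_step m) x q ->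
  map (modn^~ m) p = map (modn^~ m) q -> p = q.
Proof.
elim: p x q => [|y p IHp] x [|z q] //=.
move=> /andP[/andP[/andP[_ le_y] y_short] sp].
move=> /andP[/andP[/andP[_ le_z] z_short] sq] [eq_yz].
(* Both entries lie among the m integers x + 2 - m, ..., x + 1. *)
have eq_y : y = z.
  wlog le_yz : y z le_y y_short le_z z_short eq_yz {sp sq} / y <= z.
    by case/orP: (leq_total y z) => le_yz IH; [| apply/esym]; exact: IH.
  move: y_short le_z => /= y_short le_z.
  by move/esym/eqP: eq_yz; rewrite eqn_mod_dvd // /dvdn modn_small; lia.
by rewrite -eq_y in sq * => /(IHp _ _ sp sq)->.
Qed.

(** * The term operations of a directed cycle *)

(** Depths, in preorder, of the vertices of the rooted tree of a term: the tree
    of t1 t2 hangs the tree of t2 from the root of the tree of t1. *)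
Fixpoint depths (X : Type) (t : term X) : seq nat :=
  match t with
  | Var _ => [:: 0]
  | Mul t1 t2 => depths t1 ++ map succn (depths t2)
  end.

Lemma size_depths (X : Type) (t : term X) : size (depths t) = size (vars t).
Proof. by elim: t => //= t1 IH1 t2 IH2; rewrite !size_cat size_map IH1 IH2. Qed.

Lemma depths_zag (X : Type) (t : term X) :
  exists2 p, depths t = 0 :: p & path zag_step 0 p.
Proof.
elim: t => [x|t1 [p1 /= -> z1] t2 [p2 -> z2]]; first by exists [::].
exists (p1 ++ 1 :: map succn p2) => //=.
rewrite cat_path z1 /= -[1]/(succn 0) path_map.
by apply: sub_path z2 => x y /andP[].
Qed.

(** Adds the vertex x as the last child of the vertex of depth h on the rightmost
    branch of the tree of t, so that x becomes the last vertex in preorder.  The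
    case of a variable with h > 0 is a default: there the branch is too short. *)
Fixpoint graft (X : Type) (t : term X) (x : X) (h : nat) : term X :=
  match t, h with
  | Mul t1 t2, h'.+1 => Mul t1 (graft t2 x h')
  | _, _ => Mul t (Var x)
  end.

Lemma vars_graft (X : Type) (t : term X) (x : X) (h : nat) :
  vars (graft t x h) = rcons (vars t) x.
Proof.
elim: t h => [y|t1 _ t2 IH] [|h] //=; rewrite ?IH -?rcons_cat //.
by rewrite cats1.
Qed.

Lemma depths_graft (X : Type) (t : term X) (x : X) (h : nat) :
  h <= last 0 (depths t) -> depths (graft t x h) = rcons (depths t) h.+1.
Proof.
elim: t h => [y|t1 _ t2 IH] [|h] //=; first by rewrite cats1.
have [p2 Dd2 _] := depths_zag t2.
rewrite last_cat Dd2 /= last_map => le_h.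
by rewrite IH ?Dd2 // map_rcons rcons_cat.
Qed.

(** A vertex that follows a vertex of depth d in preorder has depth h with
    0 < h <= d + 1, hence its parent is on the rightmost branch of the tree built
    so far; so a tree with given depths is built by successive grafts. *)
Lemma depths_surj (X : Type) (xs : seq X) (p : seq nat) :
    size xs = (size p).+1 -> path zag_step 0 p ->
  exists2 t, vars t = xs & depths t = 0 :: p.
Proof.
elim/last_ind: p xs => [|p h IHp] xs.
  by case: xs => [|x []] // _ _; exists (Var x).
case/lastP: xs => [|xs x]; rewrite !size_rcons ?rcons_path // => -[size_xs].
move=> /andP[/(IHp _ size_xs)[t <- Dd] /andP[h_gt0 le_h]].
exists (graft t x h.-1); first exact: vars_graft.
by rewrite depths_graft Dd /= ?prednK //; lia.
Qed.

Lemma iter_ordS (m d : nat) (k : 'I_m) :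
  iter d (@ordS m) k = (k + d) %% m :> nat.
Proof.
elim: d => [|d IHd] /=; first by rewrite addn0 modn_small.
by rewrite IHd -addn1 modnDml addn1 addnS.
Qed.

(** The only possible homomorphism to the directed cycle that sends the root to
    k, listed in the preorder of a tree with depths d. *)
Definition walk (m : nat) (k : 'I_m) (d : seq nat) : seq (option 'I_m) :=
  [seq Some (iter i (@ordS m) k) | i <- d].

(** A product t1 t2 has value k exactly when t1 has value k and t2 has value
    k + 1, and adding 1 to the image of the root of t2 has the same effect as
    adding 1 to all the depths in its tree. *)
Lemma eval_depths (X : Type) (m : nat) (a : X -> option 'I_m) (t : term X)
    (k : 'I_m) :
  eval (graph_mul (dicycle m)) a t = Some k <->
  map a (vars t) = walk k (depths t).
Proof.
elim: t k => [x|t1 IH1 t2 IH2] k /=; first by split=> [->|[->]].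
have eval_mul : graph_mul (dicycle m) (eval (graph_mul (dicycle m)) a t1)
      (eval (graph_mul (dicycle m)) a t2) = Some k <->
    eval (graph_mul (dicycle m)) a t1 = Some k /\
    eval (graph_mul (dicycle m)) a t2 = Some (ordS k).
  case: (eval _ a t1) => [u|]; last by split=> // -[].
  case: (eval _ a t2) => [v|] /=; last by split=> // -[].
  rewrite /dicycle /=; case: eqP => [->|ne_v].
    by split=> [[->]|[]].
  by split=> // -[[Du] [Dv]]; case: ne_v; rewrite Du.
rewrite eval_mul IH1 IH2 map_cat /walk map_cat -map_comp.
have -> : [seq Some (iter i (@ordS m) (ordS k)) | i <- depths t2] =
    [seq Some (iter i.+1 (@ordS m) k) | i <- depths t2].
  by apply: eq_map => i; rewrite iterSr.
split=> [[-> ->] //|/eqP].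
by rewrite eqseq_cat ?size_map ?size_depths // => /andP[/eqP-> /eqP->].
Qed.

(** The term operation of any bracketing with depth sequence d: as
    d starts with 0, the only possible k is the value of the first variable. *)
Definition cycle_op (m n : nat) (d : seq nat) :
    {ffun {ffun 'I_n -> option 'I_m} -> option 'I_m} :=
  [ffun a : {ffun 'I_n -> option 'I_m} => [pick k | codom a == walk k d]].

Lemma term_op_cycle (m n : nat) (t : term 'I_n) :
  bracketing t -> term_op (graph_mul (dicycle m)) t = cycle_op m n (depths t).
Proof.
move=> vars_t; apply/ffunP => a; rewrite !ffunE codomE -vars_t.
case: pickP => [k /eqP /eval_depths //|no_walk].
case Dk: (eval _ a t) => [k|//].
by move/eval_depths/eqP: Dk; rewrite no_walk.
Qed.

Lemma eq_walk (m : nat) (k : 'I_m) (d e : seq nat) :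
  walk k d = walk k e <-> map (modn^~ m) d = map (modn^~ m) e.
Proof.
elim: d e => [|i d IHd] [|j e] //=.
suff eq_iter : iter i (@ordS m) k = iter j (@ordS m) k <-> i %% m = j %% m.
  by split=> -[/eq_iter-> /IHd->].
split=> [/(congr1 val) /=|eq_ij].
  by rewrite !iter_ordS => /eqP; rewrite eqn_modDl => /eqP.
by apply: val_inj; rewrite /= !iter_ordS -modnDmr eq_ij modnDmr.
Qed.

(** The depths modulo m are recovered by evaluating the operation at the
    homomorphism itself: there the value is finite, and an assignment that is a
    walk for both sequences from the same vertex forces equal residues. *)
Lemma eq_cycle_op (m n : nat) (d e : seq nat) :
    0 < m -> size d = n ->
  cycle_op m n d = cycle_op m n e <-> map (modn^~ m) d = map (modn^~ m) e.
Proof.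
move=> m_gt0 size_d; split=> [|eq_de]; last first.
  apply/ffunP => a; rewrite !ffunE; apply: eq_pick => k /=.
  by rewrite (eq_walk k d e).2.
pose k0 := Ordinal m_gt0.
pose a := [ffun i : 'I_n => nth None (walk k0 d) i].
have Da : codom a = walk k0 d.
  rewrite codomE (eq_map (g := nth None (walk k0 d) \o val)); last first.
    by move=> i; rewrite ffunE.
  have size_w : size (walk k0 d) = n by rewrite size_map.
  by rewrite map_comp val_enum_ord -size_w; exact: mkseq_nth.
move/ffunP/(_ a); rewrite !ffunE Da.
case: pickP => [k /eqP Dk|/(_ k0)]; last by rewrite eqxx.
case: pickP => // k' /eqP Dk' [eq_k]; rewrite -eq_k in Dk'.
by apply/(eq_walk k); rewrite -Dk.
Qed.

Lemma card_pred_I (F : finType) (P : pred F) : [set x | P x] #= `I_#|P|.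
Proof.
have inj_idx : {in [set x | P x] &, injective (index^~ (enum P))}.
  move=> x y /set_mem Px /set_mem Py; apply: (index_inj x);
    by rewrite mem_enum.
rewrite card_eq_sym; apply: card_eq_trans (inj_card_eq inj_idx).
suff -> : `I_#|P| = (index^~ (enum P)) @` [set x | P x] by exact: card_eqxx.
apply/seteqP; split=> [i /= lti|_ [x Px <-]] /=; last first.
  by rewrite cardE index_mem mem_enum.
have x0 := enum_val (Ordinal lti).
exists (nth x0 (enum P) i); last by rewrite index_uniq ?enum_uniq // -cardE.
have : nth x0 (enum P) i \in enum P by rewrite mem_nth -?cardE.
by rewrite mem_enum.
Qed.

(** * Dyck paths as sequences of heights *)

(** The part of a Dyck path that starts at height x, when its up-steps reach the
    heights p; it ends with the descent to the axis. *)
Fixpoint dyck_word (x : nat) (p : seq nat) : seq bool :=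
  match p with
  | [::] => nseq x D
  | y :: q => nseq (x.+1 - y) D ++ U :: dyck_word y q
  end.

(** Recovers p from [dyck_word h p]. *)
Fixpoint up_heights (h : nat) (w : seq bool) : seq nat :=
  match w with
  | [::] => [::]
  | true :: w' => h.+1 :: up_heights h.+1 w'
  | false :: w' => up_heights h.-1 w'
  end.

(** Suffixes of Dyck paths that start at height h, in a form suited to induction;
    [dyckE] is the link with partial heights. *)
Fixpoint dyck_from (h : nat) (w : seq bool) : bool :=
  match w with
  | [::] => h == 0
  | true :: w' => dyck_from h.+1 w'
  | false :: w' => (0 < h) && dyck_from h.-1 w'
  end.

Lemma height_cons (s : bool) (w : seq bool) :
  height (s :: w) = ((if s == U then 1 else -1) + height w)%R.
Proof. by rewrite /height big_cons. Qed.

Lemma height_count (w : seq bool) :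
  height w = ((count_mem U w)%:Z - (count_mem D w)%:Z)%R.
Proof.
elim: w => [|s w IHw]; first by rewrite /height big_nil.
by rewrite height_cons IHw; case: s => /=; lia.
Qed.

Lemma dyck_fromP (h : nat) (w : seq bool) :
  dyck_from h w <->
  (h%:Z + height w = 0)%R /\ forall i, (0 <= h%:Z + height (take i w))%R.
Proof.
have height0 : height [::] = 0%R by rewrite /height big_nil.
elim: w h => [|[] w IHw] h /=.
- by rewrite height0; split=> [/eqP-> //|[]]; lia.
- rewrite IHw height_cons /=; split=> -[end0 nneg]; split; try by lia.
    case=> [|i] /=; first by rewrite height0; lia.
    by rewrite height_cons /=; have := nneg i; lia.
  by move=> i; have := nneg i.+1; rewrite /= height_cons /=; lia.
rewrite height_cons /=; split=> [/andP[h_gt0 /IHw[end0 nneg]]|[end0 nneg]].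
  split; first by lia.
  case=> [|i] /=; first by rewrite height0; lia.
  by rewrite height_cons /=; have := nneg i; lia.
have h_gt0 : 0 < h by have := nneg 1; rewrite /= take0 height_cons height0 /=; lia.
rewrite h_gt0 IHw; split; first by lia.
by move=> i; have := nneg i.+1; rewrite /= height_cons /=; lia.
Qed.

Lemma dyckE (k : nat) (w : seq bool) :
  dyck k w <-> dyck_from 0 w /\ count_mem U w = k.
Proof.
rewrite dyck_fromP height_count; split=> [[cU cD nneg]|[[end0 nneg] cU]].
  by split=> //; split=> [|i]; [lia | have := nneg i; lia].
by split=> // [|i]; [lia | have := nneg i; lia].
Qed.

Lemma dyck_from_nseq (h c : nat) (w : seq bool) :
  dyck_from (c + h) (nseq c D ++ w) = dyck_from h w.
Proof. by elim: c. Qed.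

Lemma up_heights_nseq (h c : nat) (w : seq bool) :
  up_heights (c + h) (nseq c D ++ w) = up_heights h w.
Proof. by elim: c. Qed.

Lemma dyck_word_from (x : nat) (p : seq nat) :
  path zag_step x p ->
  dyck_from x (dyck_word x p) /\ count_mem U (dyck_word x p) = size p.
Proof.
elim: p x => [|y p IHp] x /=.
  by rewrite count_nseq; have := dyck_from_nseq 0 x [::]; rewrite cats0 addn0.
move=> /andP[/andP[y_gt0 le_y] /IHp[from_y count_y]].
rewrite count_cat count_nseq /= count_y; split=> //.
have {1}-> : x = (x.+1 - y) + y.-1 by lia.
by rewrite dyck_from_nseq /= prednK.
Qed.

Lemma dyck_wordK (x : nat) (p : seq nat) :
  path zag_step x p -> up_heights x (dyck_word x p) = p.
Proof.
elim: p x => [|y p IHp] x /=.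
  by have := up_heights_nseq 0 x [::]; rewrite cats0 addn0.
move=> /andP[/andP[y_gt0 le_y] /IHp{2}<-].
have {1}-> : x = (x.+1 - y) + y.-1 by lia.
by rewrite up_heights_nseq /= prednK.
Qed.

Lemma up_heightsK (h : nat) (w : seq bool) :
  dyck_from h w ->
  path zag_step h (up_heights h w) /\ dyck_word h (up_heights h w) = w.
Proof.
elim: w h => [|[] w IHw] h /=; first by move/eqP->.
  by move=> /IHw[-> ->]; rewrite subnn /zag_step /= leqnn.
case: h => [|h] //= /IHw[]; case: up_heights => [|y p] /= zp <- //.
have /andP[/andP[y_gt0 le_y] ->] := zp.
by rewrite subSn // /zag_step /= y_gt0 leqW.
Qed.

(** An occurrence of D^m U inside D^c U w either ends at the U displayed, which
    needs m <= c, or lies in w, because the only U of D^m U is its last letter. *)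
Lemma infix_run (m c : nat) (w : seq bool) :
  infix (rcons (nseq m D) U) (nseq c D ++ U :: w) =
  (m <= c) || infix (rcons (nseq m D) U) w.
Proof.
have prefix_run c' :
    prefix (rcons (nseq m D) U) (nseq c' D ++ U :: w) = (m == c').
  by elim: c' m => [|c' IHc] [|m'] //=; rewrite prefix0s.
elim: c => [|c IHc].
  by have := prefix_run 0; rewrite /= => ->; rewrite leqn0.
have := prefix_run c.+1; rewrite /= => ->.
by rewrite IHc orbA [in RHS]leq_eqVlt ltnS.
Qed.

(** The final descent is followed by no U, so it creates no occurrence of D^m U
    whatever its length; each other run of D corresponds to a step of p. *)
Lemma short_avoids (m x : nat) (p : seq nat) :
  path zag_step x p ->
  path (short_step m) x p = ~~ infix (rcons (nseq m D) U) (dyck_word x p).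
Proof.
elim: p x => [|y p IHp] x /=.
  move=> _; apply/esym/negP => /mem_infix /(_ U).
  by rewrite mem_rcons mem_head mem_nseq andbF => /(_ isT).
move=> /andP[zs /IHp->]; rewrite infix_run negb_or -ltnNge.
by rewrite -[short_step m x y]/(zag_step x y && (x.+1 - y < m)) zs.
Qed.

(** * The three counts *)

Lemma card_image (T V : Type) (S : set T) (A : set V) (f : T -> V) (c : nat) :
  {in S &, injective f} -> A = f @` S -> S #= `I_c -> A #= `I_c.
Proof. by move=> inj_f ->; apply: card_eq_trans; exact: inj_card_eq. Qed.

(** The zag sequences with short steps, without their initial 0: the three sets
    to be counted are injective images of this one. *)
Definition short_paths (m k : nat) : set (seq nat) :=
  [set p | size p = k /\ path (short_step m) 0 p].

Lemma card_short_paths (m k : nat) :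
    0 < m ->
  short_paths m k #= `I_(assoc_spectrum (graph_mul (dicycle m)) k.+1).
Proof.
move=> m_gt0; pose op p := cycle_op m k.+1 (0 :: p).
have inj_op : {in short_paths m k &, injective op}.
  move=> p q /set_mem[size_p sp] /set_mem[_ sq].
  have size_0p : size (0 :: p) = k.+1 by rewrite /= size_p.
  by move/(eq_cycle_op _ m_gt0 size_0p) => -[]; exact: short_rep_unique sp sq.
rewrite card_eq_sym; apply/(card_eq_trans _ (inj_card_eq inj_op)).
rewrite card_eq_sym; apply: card_eq_trans (card_pred_I _).
rewrite -[X in _ #= X]/[set f | _]; set A := [set f | _].
suff -> : A = op @` short_paths m k by exact: card_eqxx.
apply/seteqP; split=> [f /asboolP[t vars_t ->]|_ [p [size_p sp] <-]].
  have [p Dd zp] := depths_zag t.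
  have size_p : size p = k.
    have := size_depths t; rewrite vars_t Dd size_enum_ord => -[] //.
  have [q sq eq_qp] := short_rep_exists m_gt0 zp (leqnn 0).
  exists q.
    by split=> //; rewrite -size_p -(size_map (modn^~ m)) eq_qp size_map.
  rewrite term_op_cycle // Dd; apply/esym.
  by apply/(eq_cycle_op _ m_gt0); rewrite /= ?size_p ?eq_qp.
have [|t vars_t Dd] := @depths_surj _ (enum 'I_k.+1) p _ (path_short_zag sp).
  by rewrite size_enum_ord size_p.
by apply/asboolP; exists t => //; rewrite term_op_cycle // Dd.
Qed.

Theorem proposition5p4 (m n : nat) (hm : 1 <= m) (hn : 1 <= n) :
  assoc_spectrum (graph_mul (dicycle m)) n = modular_catalan m n.-1 /\
  [set d : seq nat | [/\ size d = n, zag d & steps_within m d]]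
    #= `I_(assoc_spectrum (graph_mul (dicycle m)) n) /\
  [set p : seq bool | dyck n.-1 p /\ ~~ infix (rcons (nseq m D) U) p]
    #= `I_(assoc_spectrum (graph_mul (dicycle m)) n).
Proof.
case: n hn => // k _; split=> //=.
have cardS := card_short_paths k hm.
split.
  apply: (card_image (f := cons 0)) cardS => [p q _ _ [] //|].
  apply/seteqP; split=> [[|x p] [//= [size_p] zd sd]|_ [p [size_p sp] <-]].
    have [-> sp] := (zag_short_consE m x p).1 (conj zd sd).
    by exists p.
  have [zd sd] := (zag_short_consE m 0 p).2 (conj erefl sp).
  by split=> //=; rewrite size_p.
apply: (card_image (f := dyck_word 0)) cardS.
  move=> p q /set_mem[_ /path_short_zag zp] /set_mem[_ /path_short_zag zq].
  by move/(congr1 (up_heights 0)); rewrite !dyck_wordK.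
apply/seteqP; split=> [w [/dyckE[from_w count_w] avoid_w]|_ [p [size_p sp] <-]].
  have [zp wK] := up_heightsK from_w.
  exists (up_heights 0 w) => //; split.
    by rewrite -count_w -{2}wK (dyck_word_from zp).2.
  by rewrite short_avoids // wK.
have zp := path_short_zag sp.
have [from_p count_p] := dyck_word_from zp.
by rewrite /= -short_avoids // dyckE count_p.
Qed.
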